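(* For every integer $n\ge 1$, $$|s^{-1}(\mathrm{Av}_n(231,312,321))|=\sum_{k=0}^{n-1}\ \sum_{q\in\mathrm{Comp}_{k+1}(n-k)}C_q\,D_q=\sum_{k=0}^{n-1}\ \sum_{\lambda\in L(n-2k-1,k)}C_{\psi^{-1}(\lambda)}\,D_{\psi^{-1}(\lambda)},$$ where, in the $k$-th term of the last sum, $\psi$ is the bijection $\psi:\mathrm{Comp}_a(b)\to L(b-a,a-1)$ with $a=k+1$ and $b=n-k$.
   Context: $S_n$ is the set of permutations of $\{1,\ldots,n\}$, written as words. The stack-sorting map $s$ is defined recursively on words of distinct positive integers: $s$ sends the empty word to itself, and if $\pi=LNR$ where $N$ is the largest entry of $\pi$, then $s(\pi)=s(L)s(R)N$. Thus $s$ maps $S_n$ to $S_n$, and $s^{-1}(A)=\{\sigma\in S_n: s(\sigma)\in A\}$ for $A\subseteq S_n$. $\mathrm{Av}_n(\tau^{(1)},\ldots,\tau^{(r)})$ is the set of permutations in $S_n$ avoiding (in the classical sense) all the patterns $\tau^{(1)},\ldots,\tau^{(r)}$. $\mathrm{Comp}_a(b)$ is the set of compositions of $b$ into $a$ parts, i.e. $a$-tuples of positive integers with sum $b$. It is partially ordered by $(x_1,\ldots,x_a)\preceq(y_1,\ldots,y_a)$ if $\sum_{i=1}^\ell x_i\le\sum_{i=1}^\ell y_i$ for all $\ell\in\{1,\ldots,a\}$. For $x\in\mathrm{Comp}_a(b)$, $D_x=|\{y\in\mathrm{Comp}_a(b):y\preceq x\}|$. $C_j=\frac1{j+1}\binom{2j}{j}$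 is the $j$-th Catalan number, and for a composition $(x_0,\ldots,x_k)$, $C_{(x_0,\ldots,x_k)}=\prod_{t=0}^kC_{x_t}$. A partition is a composition with nonincreasing parts; $L(u,v)$ is the set of all partitions (including the empty partition) with at most $u$ parts and largest part at most $v$ (with $L(u,v)=\emptyset$ if $u<0$). For $x=(x_1,\ldots,x_a)\in\mathrm{Comp}_a(b)$, $\psi(x)\in L(b-a,a-1)$ is the partition that has exactly $x_i-1$ parts of size $a-i$ for each $i\in\{1,\ldots,a-1\}$ (and no other parts); the map $\psi:\mathrm{Comp}_a(b)\to L(b-a,a-1)$ is a bijection. *)

(* Defs.v *)
From mathcomp Require Import all_boot all_fingroup all_algebra.

Set Implicit Arguments.
Unset Strict Implicit.
Unset Printing Implicit Defensive.

(* One-line notation of a permutation: 'S_n acts on {0, ..., n-1}, whereas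
   words use the letters 1, ..., n. *)
Definition word (n : nat) (sigma : 'S_n) : seq nat :=
  [seq (sigma i).+1 | i <- enum 'I_n].

(* The first argument is fuel; size w is always enough, see stack_sort_cat. *)
Fixpoint stack_sort_fuel (m : nat) (w : seq nat) : seq nat :=
  if m is m'.+1 then
    if w is [::] then [::] else
    let N := \max_(x <- w) x in
    let i := index N w in
    stack_sort_fuel m' (take i w) ++ stack_sort_fuel m' (drop i.+1 w) ++ [:: N]
  else [::].

Definition stack_sort (w : seq nat) : seq nat := stack_sort_fuel (size w) w.

Definition stack_sort_preim (n : nat) (A : {set 'S_n}) : {set 'S_n} :=
  [set sigma : 'S_n | [exists tau in A, stack_sort (word sigma) == word tau]].

Definition order_iso (u v : seq nat) : bool :=
  (size u == size v) &&
  [forall i : 'I_(size u), forall j : 'I_(size u),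
     (nth 0 u i < nth 0 u j) == (nth 0 v i < nth 0 v j)].

(* The subsequences of w are the sequences mask m w. *)
Definition contains (p w : seq nat) : bool :=
  [exists m : (size w).-tuple bool, order_iso (mask m w) p].

Definition Av (n : nat) (ps : seq (seq nat)) : {set 'S_n} :=
  [set sigma : 'S_n | all (fun p => ~~ contains p (word sigma)) ps].

(* The parts of a composition of b are at most b. *)
Definition Comp (a b : nat) : {set a.-tuple 'I_b.+1} :=
  [set x : a.-tuple 'I_b.+1 |
     all (fun t : 'I_b.+1 => 0 < t) x && (\sum_(t <- x) t == b)].

Definition comp_le (a b : nat) (x y : a.-tuple 'I_b.+1) : bool :=
  [forall l : 'I_a.+1, \sum_(t <- take l x) t <= \sum_(t <- take l y) t].

Definition compD (a b : nat) (x : a.-tuple 'I_b.+1) : nat :=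
  #|[set y in Comp a b | comp_le y x]|.

(* The division is exact, see catalanE. *)
Definition catalan (j : nat) : nat := 'C(j.*2, j) %/ j.+1.

Definition compC (a b : nat) (x : a.-tuple 'I_b.+1) : nat :=
  \prod_(t <- x) catalan t.

(* Partitions are the nonincreasing sequences of positive integers; u ranges
   over the integers, and L u v is empty for u < 0. *)
Definition L (u : int) (v : nat) : {set `|u|%N.-bseq 'I_v.+1} :=
  [set lam : `|u|%N.-bseq 'I_v.+1 |
     [&& (0 <= u)%R, all (fun t : 'I_v.+1 => 0 < t) lam
       & sorted geq (map val lam)]].

(* x_i is entry i.-1 of the tuple; the result is the list of parts. *)
Definition psi (a b : nat) (x : a.-tuple 'I_b.+1) : seq nat :=
  flatten [seq nseq (nth 0 (map val x) i.-1 - 1) (a - i) | i <- iota 1 a.-1].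

(* The default value is irrelevant: psi is a bijection from Comp a b onto
   L (b - a) (a - 1). *)
Definition psi_inv (a b : nat) (lam : seq nat) : a.-tuple 'I_b.+1 :=
  odflt [tuple of nseq a ord0] [pick x in Comp a b | psi x == lam].

Lemma mem_bigmax_seq (w : seq nat) : w != [::] -> \max_(x <- w) x \in w.
Proof.
elim: w => // x [|y w] IH _; first by rewrite big_seq1 mem_head.
rewrite big_cons in_cons /maxn; case: ifP => _; last by rewrite eqxx.
by rewrite IH // orbT.
Qed.

Lemma stack_sort_fuelE (m : nat) (w : seq nat) :
  size w <= m -> stack_sort_fuel m w = stack_sort w.
Proof.
suff H k l v : size v <= k -> size v <= l ->
    stack_sort_fuel k v = stack_sort_fuel l v by move=> ?; apply: H.
elim: k l v => [|k IH] [|l] [|x v] // lek lel.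
rewrite [LHS]/= [RHS]/=; set N := \max_(y <- _) y; set i := index N (x :: v).
have lti : i < size (x :: v) by rewrite index_mem mem_bigmax_seq.
have st h : size (x :: v) <= h.+1 -> size (take i (x :: v)) <= h.
  by move=> le_h; rewrite size_take lti -ltnS (leq_trans lti).
have sd h : size (x :: v) <= h.+1 -> size (drop i v) <= h.
  by move=> le_h; rewrite size_drop (leq_trans (leq_subr _ _)).
by congr (_ ++ (_ ++ _)); apply: IH; rewrite ?st ?sd.
Qed.

Lemma stack_sort_cat (u v : seq nat) (N : nat) :
  all (fun x => x < N) (u ++ v) ->
  stack_sort (u ++ N :: v) = stack_sort u ++ stack_sort v ++ [:: N].
Proof.
rewrite all_cat => /andP[/allP ltu /allP ltv].
have maxN : \max_(x <- u ++ N :: v) x = N.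
  apply/eqP; rewrite eqn_leq; apply/andP; split; last first.
    by apply: (@leq_bigmax_seq _ _ xpredT id); rewrite ?mem_cat ?mem_head ?orbT.
  apply/bigmax_leqP_seq => x; rewrite mem_cat in_cons.
  by case/or3P=> [/ltu/ltnW|/eqP->|/ltv/ltnW].
have idxN : index N (u ++ N :: v) = size u.
  rewrite index_cat ifN ?index_head ?addn0 //.
  by apply/negP => /ltu; rewrite ltnn.
rewrite {1}/stack_sort.
have -> : size (u ++ N :: v) = (size u + size v).+1.
  by rewrite size_cat /= addnS.
have E w m : w != [::] -> stack_sort_fuel m.+1 w =
   stack_sort_fuel m (take (index (\max_(x <- w) x) w) w) ++
   stack_sort_fuel m (drop (index (\max_(x <- w) x) w).+1 w) ++
   [:: \max_(x <- w) x] by case: w.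
rewrite E; last by case: (u).
rewrite maxN idxN take_size_cat //.
have -> : drop (size u).+1 (u ++ N :: v) = v.
  by rewrite -cat_rcons drop_size_cat ?size_rcons.
by rewrite !stack_sort_fuelE ?leq_addr ?leq_addl.
Qed.

Lemma catalanE (j : nat) : catalan j * j.+1 = 'C(j.*2, j).
Proof.
rewrite divnK //.
have H : j.+1 * 'C(j.*2, j.+1) = j * 'C(j.*2, j).
  by rewrite mul_bin_left -addnn addnK.
have -> : 'C(j.*2, j) = j.+1 * ('C(j.*2, j) - 'C(j.*2, j.+1)).
  by rewrite mulnBr H -mulnBl subSnn mul1n.
exact: dvdn_mulr.
Qed.

(* Main.v *)
Require Import Defs.
From mathcomp Require Import all_boot all_fingroup all_algebra.
From mathcomp Require Import zify.

Set Implicit Arguments.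
Unset Strict Implicit.
Unset Printing Implicit Defensive.

(* A permutation avoids 231, 312 and 321 iff it is a direct sum of blocks 1 and
   21. The number f(t) of stack-sorting preimages satisfies
   f(w N) = sum over w = u v of f(u) f(v), N being the maximum, and cutting such
   a direct sum yields two words order-isomorphic to such direct sums. If t has
   k blocks 21, separated by runs of blocks 1 of lengths r_0, ..., r_k, let
   y = (r_0 + 1, ..., r_(k-1) + 1, r_k). Then f(t) is the sum of C_q over the
   compositions q that dominate y: computed from the right by peeling off the
   last part of q, this sum satisfies the same recursion as f, by the Catalan
   convolution. Summing over t, that is over y, gives the sum of C_q D_q. *)

(** * Catalan numbers *)

Lemma catalanS (j : nat) : j.+2 * catalan j.+1 = (4 * j + 2) * catalan j.
Proof.
have H0 := catalanE j; have H1 := catalanE j.+1.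
have H2 := mul_bin_diag j.*2.+2 j; have H3 := mul_bin_down j.*2.+1 j.
rewrite -doubleS -H1 in H2; rewrite /= -H0 in H3.
apply/eqP; rewrite -(eqn_pmul2l (ltn0Sn j)); apply/eqP.
rewrite (_ : j.*2.+1 - j = j.+1) in H3; last lia.
rewrite doubleS [_.-1]/= in H2; lia.
Qed.

(** Induction with the moment sum [T]. The reflection of [i] to [n - i] gives 2 T(n) = n S(n), and
    the recurrence for the first factor expresses T(n+1) + S(n+1) by T(n) and S(n). Eliminating [T]
    leaves (n+3) S(n+1) = (4n+6) S(n), the recurrence of the Catalan numbers. *)
Lemma catalan_conv (n : nat) :
  \sum_(i < n.+1) catalan i * catalan (n - i) = catalan n.+1.
Proof.
pose S n := \sum_(i < n.+1) catalan i * catalan (n - i).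
pose T n := \sum_(i < n.+1) i * (catalan i * catalan (n - i)).
have TS m : 2 * T m = m * S m.
  rewrite mul2n -addnn {1}/T (reindex_inj rev_ord_inj) -big_split /S big_distrr /=.
  apply: eq_bigr => i _; have le_im : i <= m by rewrite -ltnS.
  by rewrite subSS subKn // [catalan (m - i) * _]mulnC -mulnDl subnK.
have STS m : T m.+1 + S m.+1 = catalan m.+1 + (4 * T m + 2 * S m).
  rewrite -big_split big_ord_recl /= subn0 mul0n add0n mul1n; congr addn.
  rewrite /T /S !big_distrr -big_split; apply: eq_bigr => i _ /=.
  rewrite subSS /bump add1n.
  have := congr1 (muln^~ (catalan (m - i))) (catalanS i); lia.
rewrite -/(S n); elim: n => [|n IH]; first by rewrite /S big_ord1.
have := STS n; have := TS n; have := TS n.+1; have := catalanS n.+1.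
rewrite -/(S n) -IH => H1 H2 H3 H4.
have H5 : n.+3 * S n.+1 = n.+3 * catalan n.+2 by nia.
by apply/eqP; rewrite -(eqn_pmul2l (ltn0Sn n.+2)) H5.
Qed.

(** Both sides run over the pairs with i + l < m, grouped on the left by j = i + l. *)
Lemma exchange_big_triangle (m : nat) (F : nat -> nat -> nat) :
  \sum_(j < m) \sum_(i < j.+1) F i (j - i) = \sum_(i < m) \sum_(l < m - i) F i l.
Proof.
elim: m => [|m IH]; first by rewrite !big_ord0.
rewrite big_ord_recr /= IH [RHS]big_ord_recr /= subSn // subnn big_ord1.
rewrite [X in _ + X = _]big_ord_recr /= subnn addnA -big_split /=; congr addn.
by apply: eq_bigr => i _; rewrite subSn ?big_ord_recr // ltnW.
Qed.

(** * The fertility formula *)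

(* A direct sum of blocks 1 (false) and 21 (true) is coded by the list of its
   blocks, last block first. For a code e and m further blocks 1 on the right,
   hook_sum e m is the sum of C_q over the compositions q dominating that of
   the word. The counter m is the number of entries still available: a block 1
   adds one, and a block 21 spends m - j > 0 of them, a part of q, and adds
   one. The m entries left at the end form the first part of q. *)
Fixpoint hook_sum (e : seq bool) (m : nat) : nat :=
  match e with
  | [::] => catalan m
  | false :: e' => hook_sum e' m.+1
  | true :: e' => \sum_(j < m) catalan (m - j) * hook_sum e' j.+1
  end.

(* Cutting a block 21 in its middle leaves a block 1 on each side. *)
Fixpoint splits (e : seq bool) : seq (seq bool * seq bool) :=
  ([::], e) ::
  match e with
  | [::] => [::]
  | false :: e' => [seq (false :: p.1, p.2) | p <- splits e']
  | true :: e' =>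
      ([:: false], false :: e') :: [seq (true :: p.1, p.2) | p <- splits e']
  end.

(* The recursion for fertilities, for a word followed by m blocks 1: the second
   sum collects the splits inside these m blocks. *)
Lemma hook_sum_splits_shift (e : seq bool) (m : nat) :
  hook_sum e m.+1 =
    \sum_(p <- splits e) hook_sum p.1 m * hook_sum p.2 0
    + \sum_(i < m) catalan i * hook_sum e (m - i).
Proof.
elim: e m => [|[] e IH] m /=.
- by rewrite big_seq1 -catalan_conv big_ord_recr /= subnn addnC.
(* The split with empty first component vanishes, [hook_sum (true :: e) 0] being an empty sum. The
   split inside the block 21 will match the term j = 0 on the left. *)
- rewrite !big_cons big_map /= big_ord0 muln0 add0n.
  rewrite [X in _ = _ + X + _](_ : _ =
      \sum_(j < m) catalan (m - j) *
        \sum_(p <- splits e) hook_sum p.1 j.+1 * hook_sum p.2 0); last first.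
    rewrite (eq_bigr (fun p => \sum_(j < m) catalan (m - j) *
       (hook_sum p.1 j.+1 * hook_sum p.2 0))); last first.
      by move=> p _; rewrite big_distrl /=; apply: eq_bigr => j _; rewrite mulnA.
    by rewrite exchange_big; apply: eq_bigr => j _; rewrite big_distrr.
  rewrite big_ord_recl /= subn0 -!addnA; congr addn.
  rewrite [LHS](_ : _ = \sum_(j < m) catalan (m - j) * hook_sum e j.+2); last first.
    by apply: eq_bigr => j _; rewrite subSS.
  under [LHS]eq_bigr => j _ do rewrite IH mulnDr.
  rewrite big_split /=; congr addn.
  under [RHS]eq_bigr => i _ do rewrite big_distrr /=.
  rewrite -(exchange_big_triangle m (fun i l =>
    catalan i * (catalan (m - i - l) * hook_sum e l.+1))).
  apply: eq_bigr => j _; rewrite big_distrr /=.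
  apply: eq_bigr => i _; have lij := ltn_ord i; have ljm := ltn_ord j.
  rewrite (_ : m - i - (j - i) = m - j); last lia.
  by rewrite subSn // mulnCA.
(* The induction hypothesis at [m.+1] has one more convolution term, i = m; it is the split with
   empty first component. *)
- rewrite IH big_cons big_map /= big_ord_recr /= subSnn.
  rewrite [RHS]addnAC [LHS]addnC [X in X + _]addnC; congr (_ + _ + _).
  by apply: eq_bigr => i _; rewrite subSn // ltnW.
Qed.

Lemma hook_sum_splits (e : seq bool) :
  hook_sum e 1 = \sum_(p <- splits e) hook_sum p.1 0 * hook_sum p.2 0.
Proof. by rewrite hook_sum_splits_shift big_ord0 addn0. Qed.

(** * Preimages under the stack-sorting map *)

Lemma perm_stack_sort (w : seq nat) : perm_eq (stack_sort w) w.
Proof.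
suff H m : size w <= m -> perm_eq (stack_sort_fuel m w) w by apply: H.
elim: m w => [|m IH] [|x w] // le_m; pose N := \max_(y <- x :: w) y.
pose i := index N (x :: w).
have mN : N \in x :: w by rewrite mem_bigmax_seq.
have lti : i < size (x :: w) by rewrite index_mem.
have le1 : size (take i (x :: w)) <= m.
  by rewrite size_take lti -ltnS (leq_trans lti).
have le2 : size (drop i w) <= m by rewrite size_drop (leq_trans (leq_subr _ _)).
rewrite -[X in perm_eq _ X](cat_take_drop i) (drop_nth 0) // nth_index //.
change (perm_eq (stack_sort_fuel m (take i (x :: w)) ++
  stack_sort_fuel m (drop i w) ++ [:: N]) (take i (x :: w) ++ N :: drop i w)).
by rewrite perm_cat ?IH // cats1 perm_rcons perm_cons IH.
Qed.

Lemma stack_sort_last (w : seq nat) : w != [::] ->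
  last 0 (stack_sort w) = \max_(x <- w) x.
Proof. by case: w => // x w _; rewrite /stack_sort /= !last_cat. Qed.

(* The list r encodes the word rev r, so that the maximum of a word with
   preimages is at the head. *)
Definition preimages (r : seq nat) : seq (seq nat) :=
  [seq u <- permutations r | stack_sort u == rev r].

Definition fertility (r : seq nat) : nat := size (preimages r).

(** Filtering [permutations r] loses no preimage, because stack-sorting only rearranges letters. *)
Lemma mem_preimages (r u : seq nat) :
  (u \in preimages r) = (stack_sort u == rev r).
Proof.
rewrite mem_filter mem_permutations andb_idr // => /eqP eq_ur.
by rewrite perm_sym -(perm_rev r) -eq_ur perm_stack_sort.
Qed.

Lemma preimages_uniq (r : seq nat) : uniq (preimages r).
Proof. by rewrite filter_uniq ?permutations_uniq. Qed.

(** A stack-sorted word ends in its maximum, and [x] is the last letter of the encoded word. *)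
Lemma fertility0 (x : nat) (r : seq nat) : has (fun y => x < y) r ->
  fertility (x :: r) = 0.
Proof.
case/hasP=> y yr ltxy; apply/eqP; rewrite -leqn0 leqNgt -has_predT.
apply/negP=> /hasP[u]; rewrite mem_preimages => /eqP eq_u _.
have pu := perm_stack_sort u; rewrite eq_u in pu.
have u0 : u != [::] by rewrite -size_eq0 -(perm_size pu) size_rev.
have := stack_sort_last u0; rewrite eq_u rev_cons last_rcons => xE.
suff : y <= x by rewrite leqNgt ltxy.
rewrite xE; apply: (@leq_bigmax_seq _ _ xpredT id) => //.
by rewrite -(perm_mem pu) mem_rev in_cons yr orbT.
Qed.

(** A preimage has the form u N v, where the images of u and v concatenate to the word without N.
    Sorting preserves length, so the length of v determines the cut. *)
Lemma fertility_cons (N : nat) (r : seq nat) : all (fun x => x < N) r ->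
  fertility (N :: r) =
    \sum_(i < (size r).+1) fertility (take i r) * fertility (drop i r).
Proof.
move=> ltN.
have NrN : N \notin r by apply/negP => /(allP ltN); rewrite ltnn.
pose f (i : nat) (p : seq nat * seq nat) := p.1 ++ N :: p.2.
pose t i := [seq (u, v) | u <- preimages (drop i r), v <- preimages (take i r)].
have mt i p : (p \in t i) =
    (stack_sort p.1 == rev (drop i r)) && (stack_sort p.2 == rev (take i r)).
  case: p => u v; rewrite -!mem_preimages /=.
  apply/allpairsP/andP=> [[q [? ? [-> ->]]] // | [? ?]].
  by exists (u, v).
have NuN i p : p \in t i ->
    index N (f i p) = size p.1 /\ size p.1 = size (drop i r).
  rewrite mt => /andP[/eqP e1 _]; have p1 := perm_stack_sort p.1.
  rewrite e1 perm_rev in p1; rewrite (perm_size p1) /f index_cat ifN.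
    by rewrite index_head addn0.
  by rewrite -(perm_mem p1); apply: contra NrN => /mem_drop.
suff pE : perm_eq (preimages (N :: r))
    [seq f i p | i <- iota 0 (size r).+1, p <- t i].
  rewrite /fertility (perm_size pE) size_allpairs_dep sumnE big_map.
  rewrite -[iota 0 _]/(index_iota 0 (size r).+1).
  by rewrite big_mkord; apply: eq_bigr => i _; rewrite size_allpairs mulnC.
(* Distinct triples (i, u, v) give distinct words: the position of [N] in the word determines u and
   v, and the length of u determines i. *)
apply: uniq_perm; first exact: preimages_uniq.
  apply: allpairs_uniq_dep; first exact: iota_uniq.
    move=> i _; apply: allpairs_uniq; rewrite ?preimages_uniq //.
    by move=> [? ?] [? ?].
  move=> _ _ /allpairsPdep[i [p [si tp ->]]] /allpairsPdep[j [q [sj tq ->]]] /=.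
  have [ip sp] := NuN _ _ tp; have [iq sq] := NuN _ _ tq => eq_f.
  have /eqP : f i p = f j q by [].
  rewrite /f eqseq_cat; last first.
    by rewrite -ip -iq [f i p]eq_f.
  case/andP => /eqP e1 /eqP[e2].
  have eij : i = j.
    by move: sp; rewrite e1 sq !size_drop; move: si sj; rewrite !mem_iota; lia.
  by rewrite -eij; congr existT; case: (p) (q) e1 e2 => [? ?] [? ?] /= -> ->.
move=> x; rewrite mem_preimages rev_cons; apply/idP/allpairsPdep; last first.
  move=> [i [p [_]]]; rewrite mt => /andP[/eqP e1 /eqP e2 ->].
  rewrite /f stack_sort_cat ?e1 ?e2; last first.
    rewrite all_cat -(perm_all _ (perm_stack_sort p.1)) e1.
    rewrite -(perm_all _ (perm_stack_sort p.2)) e2 !all_rev andbC -all_cat.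
    by rewrite cat_take_drop.
  by rewrite catA -rev_cat cat_take_drop cats1.
move=> /eqP ex; have px := perm_stack_sort x.
have Nx : N \in x by rewrite -(perm_mem px) ex mem_rcons mem_head.
case/splitPr: Nx => u v in ex px *.
have ltuv : all (fun x => x < N) (u ++ v).
  rewrite -(all_rev (fun x => x < N)) in ltN.
  rewrite -(perm_all _ (_ : perm_eq (rev r) _)) //.
  by rewrite -(perm_cons N) -perm_rcons -ex (permPl px) -[N :: v]cat1s perm_catCA.
move: ex; rewrite stack_sort_cat // catA cats1 => /rcons_inj[er].
have eqr : r = rev (stack_sort v) ++ rev (stack_sort u) by rewrite -rev_cat er revK.
have sv : size (rev (stack_sort v)) = size v.
  by rewrite size_rev (perm_size (perm_stack_sort v)).
(* As [r] is reversed, its prefix comes from v, the part to the right of [N]. *)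
exists (size v), (u, v).
rewrite mem_iota mt eqr -sv take_size_cat // drop_size_cat //.
by rewrite !revK !eqxx size_cat /= leq_addr.
Qed.

(** Only comparisons enter, so the letters need not be 1, ..., n, and both pieces of a cut word
    qualify again. *)
Fixpoint rev_layered (e : seq bool) (r : seq nat) : bool :=
  match e, r with
  | [::], [::] => true
  | false :: e', x :: r' => all (fun z => z < x) r' && rev_layered e' r'
  | true :: e', x :: y :: r' =>
      [&& x < y, all (fun z => z < x) r' & rev_layered e' r']
  | _, _ => false
  end.

(** The cuts of [r] correspond in order to [splits e], which lists codes of the two pieces. Since
    [f] and [g] are arbitrary, the induction can absorb the first block into their first
    arguments. *)
Lemma sum_splits (g : seq bool -> seq bool -> nat) (f : seq nat -> seq nat -> nat)
    (e : seq bool) (r : seq nat) :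
  rev_layered e r ->
  (forall d d' u v, u ++ v = r -> rev_layered d u -> rev_layered d' v ->
     f u v = g d d') ->
  \sum_(i < (size r).+1) f (take i r) (drop i r)
    = \sum_(p <- splits e) g p.1 p.2.
Proof.
elim: e r f g => [|[] e IH] r f g.
- by case: r => // _ fg; rewrite big_ord1 big_seq1; apply: fg.
- case: r => [|x [|y r]] //= /and3P[xy xr lr] fg.
  rewrite !big_cons big_map /= 2!big_ord_recl /=; congr (_ + (_ + _)).
  + by apply: fg; rewrite //= xy xr.
  + apply: fg; rewrite //= ?drop0 ?lr ?andbT //.
    by apply: sub_all xr => z /ltn_trans; apply.
  + rewrite -(IH r (fun u v => f (x :: y :: u) v) (fun d d' => g (true :: d) d')) //.
    move=> d d' u v uv lu lv; apply: fg; rewrite /= ?uv // xy lu andbT.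
    by move: xr; rewrite -uv all_cat => /andP[].
- case: r => [|x r] //= /andP[xr lr] fg.
  rewrite big_cons big_map /= big_ord_recl /=; congr (_ + _).
  + by apply: fg; rewrite //= xr.
  + rewrite -(IH r (fun u v => f (x :: u) v) (fun d d' => g (false :: d) d')) //.
    move=> d d' u v uv lu lv; apply: fg; rewrite /= ?uv // lu andbT.
    by move: xr; rewrite -uv all_cat => /andP[].
Qed.

(** If the last block is 21, the word does not end in its maximum and both sides are 0. If it is 1,
    both sides satisfy the same recursion over cuts into shorter layered words. *)
Lemma fertility_layered (e : seq bool) (r : seq nat) :
  rev_layered e r -> fertility r = hook_sum e 0.
Proof.
have [m] := ubnP (size r); elim: m e r => // m IH [|[] e] r.
- by case: r.
- case: r => [|x [|y r]] //= _ /and3P[xy _ _]; rewrite big_ord0.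
  by apply: fertility0; rewrite /= xy.
case: r => [|x r] //= le_m /andP[xr lr].
rewrite fertility_cons // hook_sum_splits.
apply: (sum_splits (g := fun d d' => hook_sum d 0 * hook_sum d' 0)
  (f := fun u v => fertility u * fertility v) lr).
move=> d d' u v uv lu lv; rewrite (IH d) ?(IH d') //; move: le_m.
  all: rewrite -uv size_cat; lia.
Qed.

(* An inversion between entries that are not adjacent, together with any entry
   in between, forms one of the patterns 231, 312, 321. *)
Definition rev_almost_increasing (r : seq nat) : Prop :=
  forall x y z, subseq [:: z; y; x] r -> x < z.

(** From left to right: every entry after the first two is below the head [x], so comparing [x] with
    the second entry [y] decides whether the leading block is 21 or 1. *)
Lemma rev_layeredP (r : seq nat) : uniq r ->
  rev_almost_increasing r <-> exists e, rev_layered e r.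
Proof.
move=> ur; split.
  have [m] := ubnP (size r); elim: m r ur => // m IH [|x [|y r]] ur le_m inc.
  - by exists [::].
  - by exists [:: false].
  have xr z : z \in r -> z < x.
    by move=> zr; apply: (inc z y); rewrite /= !eqxx sub1seq.
  have [ltxy|ltyx] := ltnP x y.
    have [|||e le] := IH r.
    - by case/and3P: ur.
    - by move: le_m => /=; lia.
    - move=> a b c sub; apply: (inc a b c).
      exact: subseq_trans sub (subseq_trans (subseq_cons _ _) (subseq_cons _ _)).
    by exists (true :: e) => /=; rewrite ltxy le andbT; apply/allP.
  have [|||e le] := IH (y :: r).
  - by case/andP: ur.
  - by move: le_m => /=; lia.
  - move=> a b c sub; apply: (inc a b c).
    exact: subseq_trans sub (subseq_cons _ _).
  exists (false :: e); rewrite /= -/(rev_layered e (y :: r)) le andbT.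
  have: x != y by move: ur; rewrite /= in_cons negb_or; case/andP=> /andP[].
  by rewrite neq_ltn (ltnNge x) ltyx => /= -> /=; apply/allP.
case=> e; elim: e r ur => [|[] e IH] [|x r] //=.
- case: r => [|y r] // /and3P[_ _ ur] /= /and3P[ltxy /allP xr /IH incr] a b c.
  have yr z : z \in r -> z < y by move/xr/ltn_trans; apply.
  have {}incr : rev_almost_increasing r by apply: incr.
  rewrite /=; case: (c =P x) => [->|_].
    case: (b =P y) => [_|_]; first by rewrite sub1seq => /xr.
    by move/mem_subseq => /(_ a); rewrite !inE eqxx orbT => /(_ isT)/xr.
  case: (c =P y) => [->|_]; last exact: incr.
  by move/mem_subseq => /(_ a); rewrite !inE eqxx orbT => /(_ isT)/yr.
move=> /andP[_ ur] /= /andP[/allP xr /IH incr] a b c /=.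
case: (c =P x) => [->|_]; last exact: incr.
by move/mem_subseq => /(_ a); rewrite !inE eqxx orbT => /(_ isT)/xr.
Qed.

Lemma rev_layered_inj (e e' : seq bool) (r : seq nat) :
  rev_layered e r -> rev_layered e' r -> e = e'.
Proof.
elim: e e' r => [|[] e IH] [|[] e'] [|x [|y r]] //=.
- by case/and3P=> _ _ /IH eqe /and3P[_ _ /eqe ->].
- by case/and3P => lt _ _; rewrite ltnNge (ltnW lt).
- by case/andP => /andP[lt _] _; rewrite ltnNge (ltnW lt).
- by move=> /IH eqe /eqe ->.
- rewrite -/(rev_layered e _) -/(rev_layered e' _).
  by move=> /andP[_ /IH eqe] /andP[_ /eqe ->].
Qed.

(** * Enumeration of the layered permutations of given length by their codes *)

Definition weight (e : seq bool) : nat := \sum_(b <- e) b.+1.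

Lemma weight_cons (b : bool) (e : seq bool) :
  weight (b :: e) = b.+1 + weight e.
Proof. by rewrite /weight big_cons. Qed.

Fixpoint layered_word (e : seq bool) : seq nat :=
  match e with
  | [::] => [::]
  | false :: e' => (weight e').+1 :: layered_word e'
  | true :: e' => (weight e').+1 :: (weight e').+2 :: layered_word e'
  end.

Lemma perm_layered_word (e : seq bool) :
  perm_eq (layered_word e) (iota 1 (weight e)).
Proof.
elim: e => [|b e IH]; first by rewrite /weight big_nil.
rewrite weight_cons addnC iotaD add1n perm_sym perm_catC.
by case: b => /=; rewrite !perm_cons perm_sym.
Qed.

Lemma rev_layered_word (e : seq bool) : rev_layered e (layered_word e).
Proof.
have lt m : all (fun z => z < m.+1) (iota 1 m).
  by apply/allP=> x; rewrite mem_iota; lia.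
elim: e => [|[] e IH] //=;
  by rewrite IH (perm_all _ (perm_layered_word e)) lt ?ltnSn.
Qed.

Lemma perm_max_iota (x : nat) (r : seq nat) (n : nat) :
  all (fun z => z < x) r -> perm_eq (x :: r) (iota 1 n) ->
  [/\ n = x, 0 < x & perm_eq r (iota 1 x.-1)].
Proof.
case: n => [|n] /allP ltx p; first by have := perm_size p.
have xn : x = n.+1.
  have : n.+1 \in x :: r by rewrite (perm_mem p) mem_iota; lia.
  rewrite in_cons => /orP[/eqP // | /ltx].
  have : x \in iota 1 n.+1 by rewrite -(perm_mem p) mem_head.
  by rewrite mem_iota; lia.
rewrite xn; split=> //; move: p.
rewrite xn -addn1 iotaD add1n addn1 cats1 perm_sym perm_rcons.
by rewrite perm_cons perm_sym.
Qed.

Lemma rev_layered_perm_iota (e : seq bool) (r : seq nat) (n : nat) :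
  rev_layered e r -> perm_eq r (iota 1 n) -> weight e = n /\ r = layered_word e.
Proof.
elim: e r n => [|[] e IH] r n.
- case: r => // _ /perm_size; rewrite size_iota /weight big_nil => <-; by [].
- case: r => [|x [|y r]] //= /and3P[xy xr lr] p; rewrite weight_cons.
  have [||ny _ px] := @perm_max_iota y (x :: r) n.
  + by rewrite /= xy; apply: sub_all xr => z /ltn_trans; apply.
  (* In a leading block 21 the maximum [y] comes second, so the two letters are exchanged before it
     is removed. *)
  + exact: etrans (esym (perm_catCA [:: x] [:: y] r (iota 1 n))) p.
  have [yx x0 pr] := perm_max_iota xr px; have [we ->] := IH _ _ lr pr.
  by have := xy; rewrite we; split; [|congr [:: _, _ & _]]; lia.
- case: r => [|x r] //= /andP[xr lr] p; rewrite weight_cons.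
  have [nx x0 pr] := perm_max_iota xr p; have [we ->] := IH _ _ lr pr.
  by rewrite we nx add1n prednK.
Qed.

Fixpoint codes (n : nat) : seq (seq bool) :=
  match n with
  | 0 => [:: [::]]
  | n'.+1 => [seq false :: e | e <- codes n'] ++
      match n' with 0 => [::] | m.+1 => [seq true :: e | e <- codes m] end
  end.

Lemma codesSS (n : nat) : codes n.+2 =
  [seq false :: e | e <- codes n.+1] ++ [seq true :: e | e <- codes n].
Proof. by []. Qed.

Lemma mem_codes (n : nat) (e : seq bool) : (e \in codes n) = (weight e == n).
Proof.
have w0 : weight [::] = 0 by rewrite /weight big_nil.
have inj b : injective (cons b : seq bool -> seq bool) by move=> ? ? [].
have nm b c d s : b != c -> (b :: d \in [seq c :: e | e <- s]) = false.
  by move=> bc; apply/mapP=> -[? _ [bcE _]]; rewrite bcE eqxx in bc.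
have n0 c s : ([::] \in [seq c :: e | e <- s]) = false by apply/mapP=> -[].
have [m] := ubnP n; elim: m n e => // m IH [|[|n]] [|[] e] le_m;
  rewrite ?codesSS ?w0 ?weight_cons //.
- by rewrite mem_cat (mem_map (inj false)) -[[:: [::]]]/(codes 0) IH ?in_nil ?orbF.
- by rewrite mem_cat !n0.
- rewrite mem_cat nm // (mem_map (inj true)) IH //=; lia.
- by rewrite mem_cat (mem_map (inj false)) nm // orbF IH.
Qed.

Lemma codes_uniq (n : nat) : uniq (codes n).
Proof.
have inj b : injective (cons b : seq bool -> seq bool) by move=> ? ? [].
have [m] := ubnP n; elim: m n => // m IH [|[|n]] // le_m.
have lt1 : n.+1 < m by [].
rewrite codesSS cat_uniq !(map_inj_uniq (inj _)).
rewrite (IH _ lt1) (IH _ (ltnW lt1)) andbT /=.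
by apply/hasPn=> _ /mapP[e _ ->]; apply/mapP=> -[? _ []].
Qed.

(** * Pattern avoidance *)

Lemma order_isoP (u v : seq nat) :
  reflect (size u = size v /\ forall i j, i < size u -> j < size u ->
             (nth 0 u i < nth 0 u j) = (nth 0 v i < nth 0 v j))
          (order_iso u v).
Proof.
apply: (iffP andP) => [[/eqP-> /'forall_'forall_eqP h]|[-> h]].
  by split=> // i j ltiu ltju; apply: (h (Ordinal ltiu) (Ordinal ltju)).
by split=> //; apply/'forall_'forall_eqP=> i j; apply: h.
Qed.

Lemma containsP (p w : seq nat) :
  reflect (exists2 u, subseq u w & order_iso u p) (contains p w).
Proof.
apply: (iffP existsP) => [[m iso] | [u /subseqP[m sm ->] iso]].
  by exists (mask m w); first exact: mask_subseq.
by exists (Tuple (introT eqP sm)).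
Qed.

(** The three patterns are exactly the permutations of length three whose last letter is below the
    first. *)
Lemma avoidP (w : seq nat) : uniq w ->
  reflect (rev_almost_increasing (rev w))
    (all (fun p => ~~ contains p w) [:: [:: 2; 3; 1]; [:: 3; 1; 2]; [:: 3; 2; 1]]).
Proof.
move=> uw; apply: (iffP allP) => [av x y z | inc p pP]; last first.
  apply/containsP => -[u sub /order_isoP[su iso]].
  have [su3 p20] : size u = 3 /\ nth 0 p 2 < nth 0 p 0.
    by move: pP su; rewrite !inE => /or3P[] /eqP->.
  case: u su3 => [|x [|y [|z []]]] // _ in sub su iso.
  have := iso 2 0 isT isT; rewrite p20 /= ltnNge => /negP; apply.
  by apply/ltnW/(inc _ y); rewrite -(subseq_rev _ w) in sub.
rewrite -subseq_rev revK -[rev [:: z; y; x]]/[:: x; y; z] => sub.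
rewrite ltnNge; apply/negP => lezx.
have := subseq_uniq sub uw; rewrite /= !inE !negb_or andbT => /andP[/andP[xy xz] yz].
have {lezx xz} ltzx : z < x by rewrite ltn_neqAle eq_sym xz.
have noiso p : p \in [:: [:: 2; 3; 1]; [:: 3; 1; 2]; [:: 3; 2; 1]] ->
    ~ order_iso [:: x; y; z] p.
  by move=> /av/containsP nop iso; apply: nop; exists [:: x; y; z].
have [ltxy|leyx] := ltnP x y.
  apply: (noiso [:: 2; 3; 1]) => //.
  by apply/order_isoP; split=> // -[|[|[|?]]] [|[|[|?]]] //= _ _; lia.
have [ltyz|lezy] := ltnP y z.
  apply: (noiso [:: 3; 1; 2]) => //.
  by apply/order_isoP; split=> // -[|[|[|?]]] [|[|[|?]]] //= _ _; lia.
apply: (noiso [:: 3; 2; 1]) => //.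
by apply/order_isoP; split=> // -[|[|[|?]]] [|[|[|?]]] //= _ _; lia.
Qed.

Lemma word_uniq (n : nat) (s : 'S_n) : uniq (word s).
Proof. by rewrite map_inj_uniq ?enum_uniq // => i j [] /val_inj/perm_inj. Qed.

Lemma word_inj (n : nat) : injective (@word n).
Proof.
move=> s t /eq_in_map eq_st; apply/permP=> i; apply: val_inj.
by have [] := eq_st i (mem_enum _ _).
Qed.

Lemma perm_word (n : nat) (s : 'S_n) : perm_eq (word s) (iota 1 n).
Proof.
have sub : {subset word s <= iota 1 n}.
  by move=> _ /mapP[i _ ->]; rewrite mem_iota /= add1n ltnS ltn_ord.
apply: uniq_perm; rewrite ?word_uniq ?iota_uniq //.
case: (uniq_min_size (word_uniq s) sub) => //.
by rewrite size_iota size_map size_enum_ord.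
Qed.

Lemma perm_words (n : nat) :
  perm_eq [seq word s | s <- enum 'S_n] (permutations (iota 1 n)).
Proof.
have uw : uniq [seq word s | s <- enum 'S_n].
  by rewrite map_inj_uniq ?enum_uniq //; apply: word_inj.
apply: uniq_perm; rewrite ?permutations_uniq //.
have sz : size (permutations (iota 1 n)) <= size [seq word s | s <- enum 'S_n].
  by rewrite size_permutations ?iota_uniq // size_iota size_map -cardE card_Sn.
have sub : {subset [seq word s | s <- enum 'S_n] <= permutations (iota 1 n)}.
  by move=> _ /mapP[s _ ->]; rewrite mem_permutations perm_word.
by case: (uniq_min_size uw sub sz).
Qed.

Lemma count_mem_sum (T U : eqType) (f : T -> U) (s : seq T) (r : seq U) :
  uniq r -> count (fun x => f x \in r) s = \sum_(y <- r) count (fun x => f x == y) s.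
Proof.
move=> ur; elim: s => [|x s IH] /=; first by rewrite big1.
rewrite big_split /= -IH; congr addn.
rewrite -(count_uniq_mem _ ur) -sum1_count [LHS]big_mkcond /=.
by apply: eq_bigr => y _; rewrite eq_sym; case: eqP.
Qed.

(** [R] lists the avoiding words once each, by their codes, and the preimage is the disjoint union
    of the fibres over [R]. *)
Lemma card_stack_sort_preim_av (n : nat) :
  #|stack_sort_preim (Av n [:: [:: 2; 3; 1]; [:: 3; 1; 2]; [:: 3; 2; 1]])|
    = \sum_(e <- codes n) hook_sum e 0.
Proof.
set A := Av _ _; pose R := [seq rev (layered_word e) | e <- codes n].
have uR : uniq R.
  rewrite map_inj_in_uniq ?codes_uniq // => e e' _ _ /(can_inj revK) eq_ee'.
  apply: (rev_layered_inj (rev_layered_word e)); rewrite eq_ee'.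
  exact: rev_layered_word.
have pR e : weight e = n -> perm_eq (rev (layered_word e)) (iota 1 n).
  by move=> <-; rewrite perm_rev perm_layered_word.
have memR s : (word s \in R) = (s \in A).
  rewrite inE; apply/mapP/avoidP; first exact: word_uniq.
    move=> [e _ ->]; rewrite revK.
    apply/rev_layeredP; last by exists e; apply: rev_layered_word.
    by rewrite (perm_uniq (perm_layered_word e)) iota_uniq.
  move/rev_layeredP; rewrite rev_uniq word_uniq => /(_ isT)[e le].
  have [|we sE] := rev_layered_perm_iota (n := n) le.
    by rewrite perm_rev perm_word.
  by exists e; rewrite ?mem_codes ?we // -sE revK.
transitivity (count (fun w => stack_sort w \in R) (permutations (iota 1 n))).
  rewrite -(seq.permP (perm_words n)) -sum1_count big_map -sum1_card big_enum_cond /=.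
  apply: eq_bigl => s; rewrite inE.
  have : stack_sort (word s) \in [seq word t | t <- enum 'S_n].
    rewrite (perm_mem (perm_words n)) mem_permutations.
    exact: perm_trans (perm_stack_sort _) (perm_word s).
  case/mapP => t _ ->; rewrite memR.
  apply/exists_inP/idP => [[u uA /eqP/word_inj->] //|tA].
  by exists t.
rewrite count_mem_sum // big_map; apply: eq_big_seq => e.
rewrite mem_codes => /eqP we.
rewrite -(fertility_layered (rev_layered_word e)) /fertility size_filter.
by apply/seq.permP/perm_permutations; rewrite perm_sym -perm_rev pR.
Qed.

(** * Compositions *)

(** An unbounded list version of [Comp], suited to recursion on the first part; it will be matched
    with the reversals of the tuples in [Comp]. *)
Fixpoint comps (a b : nat) : seq (seq nat) :=
  if a is a'.+1 then [seq y :: Y | y <- iota 1 b, Y <- comps a' (b - y)]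
  else if b is 0 then [:: [::]] else [::].

Lemma mem_comps (a b : nat) (Y : seq nat) :
  (Y \in comps a b) = [&& size Y == a, all (fun y => 0 < y) Y & sumn Y == b].
Proof.
elim: a b Y => [|a IH] b [|y Y]; [by case: b | by case: b | |].
  by apply/allpairsPdep => -[? [? []]].
apply/allpairsPdep/idP => [[z [Z [+ + [-> ->]]]] | ].
  rewrite mem_iota IH /= eqSS => /andP[z0 zb] /and3P[-> -> /eqP->].
  by rewrite z0 /=; lia.
rewrite /= eqSS => /and3P[sY /andP[y0 aY] /eqP sb].
by exists y, Y; rewrite mem_iota IH sY aY; split=> //; lia.
Qed.

Lemma comps_uniq (a b : nat) : uniq (comps a b).
Proof.
elim: a b => [|a IH] b; first by case: b.
apply: allpairs_uniq_dep; rewrite ?iota_uniq //.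
by move=> [y Y] [z Z] _ _ /= [-> ->].
Qed.

Lemma big_comps (F : seq nat -> nat) (a b : nat) :
  \sum_(Y <- comps a.+1 b) F Y =
    \sum_(1 <= y < b.+1) \sum_(Y <- comps a (b - y)) F (y :: Y).
Proof. by rewrite /index_iota subSS subn0 -big_allpairs_dep. Qed.

(* slack_sum Y m is hook_sum at m + 1 for the code with y - 1 blocks 1 for each
   part y of Y, and a block 21 between consecutive parts. *)
Fixpoint slack_sum (Y : seq nat) (m : nat) : nat :=
  if Y is y :: Y' then \sum_(j < m + y) catalan (m + y - j) * slack_sum Y' j
  else m == 0.

(** The counter [m] is the surplus of the prefix sums of [Y] over those of [Q], which must never
    become negative. *)
Fixpoint dominated (m : nat) (Y Q : seq nat) : bool :=
  match Y, Q with
  | y :: Y', q :: Q' => (q <= m + y) && dominated (m + y - q) Y' Q'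
  | _, _ => true
  end.

Lemma dominatedP (m : nat) (Y Q : seq nat) : size Q = size Y ->
  reflect (forall l, l <= size Y -> sumn (take l Q) <= m + sumn (take l Y))
          (dominated m Y Q).
Proof.
elim: Y Q m => [|y Y IH] [|q Q] m //=; first by move=> _; constructor; case.
move=> [sQ]; apply: (iffP andP) => [[qy /IH dom] [|l] //= lel | dom].
  by have := dom sQ l lel; lia.
have qy : q <= m + y by have := dom 1 isT; rewrite /= !take0 /= !addn0.
split=> //; apply/IH => // l lel; have := dom l.+1 lel; rewrite /=; lia.
Qed.

(** The summation index [j] is the surplus left after the first part q = m + y - j of [Q]. *)
Lemma slack_sumE (Y : seq nat) (m : nat) :
  slack_sum Y m =
    \sum_(Q <- comps (size Y) (m + sumn Y) | dominated m Y Q)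
      \prod_(t <- Q) catalan t.
Proof.
elim: Y m => [|y Y IH] m.
  by case: m => [|m] /=; rewrite ?addn0 ?big_seq1 ?big_nil.
(* First parts above [m + y] violate domination and contribute nothing. *)
rewrite big_mkcond big_comps (@big_cat_nat _ _ _ (m + y).+1) /=; [|lia|lia].
rewrite [X in _ = _ + X]big_nat [X in _ = _ + X]big1 ?addn0; last first.
  by move=> q /andP[ltq _]; rewrite big1 // => Q _; rewrite leqNgt ltq.
rewrite big_add1 /= big_mkord (reindex_inj rev_ord_inj); apply: eq_bigr => j _ /=.
have ltj := ltn_ord j.
rewrite subKn // IH big_distrr big_mkcond /= -/(size Y) ltj.
rewrite (_ : m + (y + sumn Y) - j.+1 = m + y - j.+1 + sumn Y); last lia.
by apply: eq_bigr => Q _; rewrite big_cons; case: ifP.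
Qed.

(** The first part is 1 or can be lowered by 1. Members of [comps a.+1 b] are nonempty, so the
    default of [head] never occurs. *)
Lemma sum_compsS (F : seq nat -> nat) (a b : nat) :
  \sum_(Y <- comps a.+1 b.+1) F Y = \sum_(Y <- comps a b) F (1 :: Y)
    + \sum_(Y <- comps a.+1 b) F ((head 0 Y).+1 :: behead Y).
Proof.
by rewrite !big_comps big_nat_recl // subSS subn0.
Qed.

(** A code with i blocks 21 has n - 2i blocks 1, whence i + 1 parts of sum n + 1 - i. A first part
    above 1 reflects a leading block 1, and a first part 1 followed by others a leading block 21.
    The bound [k] is free since the terms with i > n are empty. *)
Lemma sum_codes (n k : nat) : n < k -> forall m,
  \sum_(e <- codes n) hook_sum e m.+1 =
    \sum_(i < k) \sum_(Y <- comps i.+1 (n.+1 - i)) slack_sum Y m.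
Proof.
have [p] := ubnP n; elim: p n k => // p IH n k; rewrite ltnS => le_np ltnk m.
have comps0 a : comps a.+1 0 = [::] by [].
case: n => [|n] in le_np ltnk *.
  case: k ltnk => // k _; rewrite big_ord_recl [X in _ + X]big1 ?addn0; last first.
    by move=> i _; rewrite /= big_nil.
  rewrite !big_seq1 /= addn1 big_ord_recl big1 => [|j _]; last by rewrite muln0.
  by rewrite subn0 muln1 addn0.
have split_i (i : 'I_k) : \sum_(Y <- comps i.+1 (n.+2 - i)) slack_sum Y m =
    \sum_(Y <- comps i (n.+1 - i)) slack_sum (1 :: Y) m +
    \sum_(Y <- comps i.+1 (n.+1 - i)) slack_sum Y m.+1.
  have [lein|ltni] := leqP i n.+1.
    rewrite subSn // sum_compsS; congr addn; apply: eq_big_seq => Y.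
    by rewrite mem_comps; case: Y => //= y Y _; rewrite addnS addSn.
  rewrite (_ : n.+2 - i = 0) 1?(_ : n.+1 - i = 0); [|lia|lia].
  by case: (val i) ltni => // ? _; rewrite !comps0 !big_nil.
rewrite (eq_bigr _ (fun i _ => split_i i)) big_split /= -IH //; last exact: ltnW.
rewrite big_cat big_map /= addnC; congr addn.
(* For i = 0 no part would follow the leading 1, and [comps 0 n.+1] is empty. *)
case: k ltnk {split_i} => // k ltnk; rewrite big_ord_recl big_nil add0n.
case: n => [|n] in le_np ltnk *.
  by rewrite big_nil big1 // => i _; rewrite lift0 subSS sub0n comps0 big_nil.
rewrite big_map; under [RHS]eq_bigr => i _ do rewrite subSS exchange_big.
rewrite /= exchange_big [RHS]exchange_big /= addn1; apply: eq_bigr => j _.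
rewrite -big_distrr /= (IH n k); [|lia|lia].
by rewrite big_distrr; apply: eq_bigr => i _; rewrite big_distrr.
Qed.

(** Codes with leading block 21 contribute 0, and a leading block 1 raises the counter from 0 to
    1. *)
Lemma sum_codes_comps (n : nat) : 0 < n ->
  \sum_(e <- codes n) hook_sum e 0 =
    \sum_(0 <= k < n) \sum_(Y <- comps k.+1 (n - k)) slack_sum Y 0.
Proof.
case: n => // n _; rewrite big_mkord -sum_codes // [codes _]/= big_cat big_map /=.
rewrite [X in _ + X]big1_seq ?addn0 // => e /=.
by case: n => // n /mapP[d _ ->]; rewrite /= big_ord0.
Qed.

(** As both totals are [b], comparing prefix sums amounts to comparing suffix sums the other way
    round, and suffixes become prefixes after reversal. *)
Lemma comp_leE (a b : nat) (x y : a.-tuple 'I_b.+1) :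
  x \in Comp a b -> y \in Comp a b ->
  comp_le y x = dominated 0 (rev (map val y)) (rev (map val x)).
Proof.
have sumE (s : seq 'I_b.+1) : \sum_(t <- s) t = sumn (map val s).
  by rewrite sumnE big_map.
rewrite !inE => /andP[_ /eqP sx] /andP[_ /eqP sy].
have cut (z : a.-tuple 'I_b.+1) l : \sum_(t <- z) t = b ->
    sumn (map val (take l z)) + sumn (map val (drop l z)) = b.
  by rewrite -sumn_cat -map_cat cat_take_drop sumE.
have sr (z : a.-tuple 'I_b.+1) l : l <= a ->
    sumn (take (a - l) (rev (map val z))) = sumn (map val (drop l z)).
  by move=> lel; rewrite take_rev sumn_rev size_map size_tuple subKn // map_drop.
apply/forallP/dominatedP; rewrite ?size_rev ?size_map ?size_tuple //= => h.
  move=> l lel; have lek : a - l <= a by exact: leq_subr.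
  rewrite -(subKn lel); move: (a - l) lek => k lek.
  have : sumn (map val (take k y)) <= sumn (map val (take k x)).
    by rewrite -!sumE; apply: (h (Ordinal (lek : k < a.+1))).
  by rewrite !sr //; have := cut x k sx; have := cut y k sy; lia.
move=> l; have lel : l <= a by rewrite -ltnS.
have := h _ (leq_subr l a); rewrite !sr // !sumE.
have := cut x l sx; have := cut y l sy; lia.
Qed.

Lemma perm_Comp (a b : nat) :
  perm_eq [seq rev (map val x) | x : a.-tuple 'I_b.+1 in Comp a b] (comps a b).
Proof.
apply: uniq_perm; rewrite ?comps_uniq //.
  rewrite map_inj_uniq ?enum_uniq // => x y /(can_inj revK)/(inj_map val_inj) ?.
  exact: val_inj.
move=> Y; rewrite mem_comps; apply/imageP/idP => [[x + ->]|/and3P[sY aY /eqP sumY]].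
  rewrite inE => /andP[ax sx]; rewrite size_rev size_map size_tuple eqxx all_rev.
  by rewrite all_map sumn_rev sumnE big_map /= ax.
have sz : size (rev (map inord Y : seq 'I_b.+1)) == a by rewrite size_rev size_map.
have YE : map val (map inord Y : seq 'I_b.+1) = Y.
  rewrite -map_comp map_id_in // => y yY /=; rewrite inordK // ltnS -sumY.
  by have := perm_to_rem yY => /perm_sumn ->; rewrite /= leq_addr.
have E : map val (Tuple sz) = rev Y by rewrite -[in RHS]YE; apply: map_rev.
exists (Tuple sz); last by rewrite E revK.
rewrite inE -(all_map val (fun t => 0 < t)) E all_rev aY.
by rewrite -(big_map val xpredT id) E -sumnE sumn_rev sumY /=.
Qed.

(** [compD q] counts the compositions y below q. Exchanging the sums leaves, for each y, the sum of
    C_q over the q dominating y. *)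
Lemma sum_Comp (a b : nat) :
  \sum_(q in Comp a b) compC q * compD q = \sum_(Y <- comps a b) slack_sum Y 0.
Proof.
rewrite -(perm_big _ (perm_Comp a b)) big_image /=.
transitivity (\sum_(q in Comp a b) \sum_(y in Comp a b | comp_le y q) compC q).
  apply: eq_bigr => q _; rewrite /compD -sum1_card big_distrr /=.
  by apply: eq_big => [y|y _]; rewrite ?muln1 // inE.
rewrite (exchange_big_dep (mem (Comp a b))) /=; last by move=> q y _ /andP[].
apply: eq_bigr => y yC.
have := yC; rewrite inE => /andP[yC0 /eqP sy].
rewrite slack_sumE add0n sumn_rev size_rev size_map size_tuple sumnE big_map sy.
rewrite -(perm_big _ (perm_Comp a b)) big_image_cond /=.
apply: eq_big => [q|q _]; last by rewrite big_rev big_map.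
by case: (boolP (q \in Comp a b)) => //= qC; rewrite -(comp_leE qC yC) yC0 eqxx.
Qed.

(** * The bijection psi *)

Lemma map_val_Comp (a b : nat) (x : a.-tuple 'I_b.+1) : x \in Comp a b ->
  all (fun t => 0 < t) (map val x) /\ sumn (map val x) = b.
Proof. by rewrite inE all_map sumnE big_map => /andP[-> /eqP->]. Qed.

Lemma Comp_of_seq (a b : nat) (X : seq nat) :
  size X = a -> all (fun t => 0 < t) X -> sumn X = b ->
  exists2 x : a.-tuple 'I_b.+1, x \in Comp a b & map val x = X.
Proof.
move=> sX aX sumX; have : rev X \in comps a b.
  by rewrite mem_comps size_rev sX all_rev aX sumn_rev sumX !eqxx.
rewrite -(perm_mem (perm_Comp a b)) => /imageP[x xC /(can_inj revK) ->].
by exists x.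
Qed.

Lemma psi_bounds (a b : nat) (x : a.-tuple 'I_b.+1) (c : nat) :
  c \in psi x -> 0 < c < a.
Proof.
move=> /flattenP[s /mapP[i + ->]] /nseqP[-> _]; rewrite mem_iota.
by case: (a) => [|a'] /=; lia.
Qed.

Lemma psi_sorted (a b : nat) (x : a.-tuple 'I_b.+1) : sorted geq (psi x).
Proof.
have geq_trans : transitive geq by move=> p q r /= qp rq; apply: leq_trans rq qp.
suff H n m : pairwise geq
    (flatten [seq nseq (nth 0 (map val x) i.-1 - 1) (a - i) | i <- iota m n]).
  by rewrite sorted_pairwise //; apply: H.
elim: n m => // n IH m.
rewrite [iota _ _]/= [flatten _]/= pairwise_cat IH andbT; apply/andP; split.
  apply/allrelP => c d /nseqP[-> _] /flattenP[s /mapP[i + ->]] /nseqP[-> _].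
  by rewrite mem_iota /=; lia.
by elim: (_ - 1) => //= p ->; rewrite andbT all_nseq /= leqnn orbT.
Qed.

(** Only the index i = a - c produces parts of size [c]; the list index is one less. *)
Lemma count_psi (a b : nat) (x : a.-tuple 'I_b.+1) (c : nat) : 0 < c < a ->
  count_mem c (psi x) = nth 0 (map val x) (a - c).-1 - 1.
Proof.
move=> /andP[c0 ca]; rewrite count_flatten sumnE !big_map.
rewrite (bigD1_seq (a - c)) ?iota_uniq ?mem_iota //=; last lia.
rewrite count_nseq /= subKn ?(ltnW ca) // eqxx mul1n big1_seq ?addn0 //.
move=> i /andP[ic]; rewrite mem_iota count_nseq /= => ia.
by rewrite (_ : (a - i == c) = false) //; apply/eqP; move/eqP: ic; lia.
Qed.

Lemma sumn_belast (k : nat) (X : seq nat) : size X = k.+1 ->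
  sumn X = \sum_(i < k) nth 0 X i + nth 0 X k.
Proof. by move=> sX; rewrite sumnE (big_nth 0) sX big_mkord big_ord_recr. Qed.

Lemma size_psi (k b : nat) (x : k.+1.-tuple 'I_b.+1) : x \in Comp k.+1 b ->
  size (psi x) + k.+1 <= b.
Proof.
move=> /map_val_Comp[/allP px sx].
have sz : size (map val x) = k.+1 by rewrite size_map size_tuple.
have pos i : i <= k -> 0 < nth 0 (map val x) i.
  by move=> ik; apply/px/mem_nth; rewrite sz.
rewrite -[leqRHS]sx (sumn_belast sz) size_flatten /shape sumnE !big_map /=.
have -> : iota 1 k = index_iota 1 k.+1 by rewrite /index_iota subn1.
rewrite big_add1 big_mkord /=.
rewrite addnS -addn1 leq_add ?pos //.
have kE : \sum_(i < k) 1 = k by rewrite sum1_card card_ord.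
rewrite -[X in _ + X <= _]kE -big_split leq_sum //= => i _.
by rewrite size_nseq subnK //; apply/pos/ltnW.
Qed.

(** The multiplicities determine the first [k] parts, and the total [b] then determines the last. *)
Lemma psi_inj (k b : nat) : {in Comp k.+1 b &, injective (@psi k.+1 b)}.
Proof.
move=> x y /map_val_Comp[/allP px sx] /map_val_Comp[/allP py sy] eq_xy.
have sz (z : k.+1.-tuple 'I_b.+1) : size (map val z) = k.+1.
  by rewrite size_map size_tuple.
have eq_nth i : i < k -> nth 0 (map val x) i = nth 0 (map val y) i.
  move=> ik; have c_bd : 0 < k - i < k.+1 by lia.
  have := count_psi x c_bd; rewrite eq_xy count_psi //.
  rewrite (_ : (k.+1 - (k - i)).-1 = i); last lia.
  have x0 : 0 < nth 0 (map val x) i by apply/px/mem_nth; rewrite sz ltnW.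
  have y0 : 0 < nth 0 (map val y) i by apply/py/mem_nth; rewrite sz ltnW.
  by move: x0 y0; do 2![case: (nth _ _ _) => // ?]; rewrite !subn1 /= => _ _ ->.
suff /(inj_map val_inj)/val_inj : map val x = map val y by [].
apply: (@eq_from_nth _ 0) => [|i]; rewrite !sz //.
rewrite ltnS leq_eqVlt => /orP[/eqP->|]; last exact: eq_nth.
move: sx; rewrite -[RHS]sy (sumn_belast (sz x)) (sumn_belast (sz y)).
by rewrite (eq_bigr _ (fun i _ => eq_nth _ (ltn_ord i))) => /addnI.
Qed.

Lemma psi_surj (k b : nat) (lam : seq nat) :
  all (fun t => 0 < t < k.+1) lam -> sorted geq lam -> size lam + k.+1 <= b ->
  exists2 x, x \in Comp k.+1 b & psi x = lam.
Proof.
move=> bl sl le_b.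
(* The first [k] parts are forced by the multiplicities; the last part will be the remainder
   [b - sumn P], positive by the size bound. *)
pose P := [seq (count_mem (k - i) lam).+1 | i <- iota 0 k].
have sP : sumn P = size lam + k.
  rewrite sumnE big_map -[k in iota 0 k]subn0 -/(index_iota 0 k) big_mkord.
  under eq_bigr => i _ do rewrite -addn1.
  rewrite big_split /= sum_nat_const card_ord muln1; congr addn.
  rewrite -sum1_size (eq_bigr (fun i : 'I_k => \sum_(t <- lam) (t == k - i))).
  2: move=> i _; rewrite -sum1_count big_mkcond.
  2: by apply: eq_bigr => t _ /=; case: eqP.
  rewrite exchange_big; apply: eq_big_seq => t /(allP bl) tk.
  have lt : k - t < k by lia.
  rewrite (bigD1 (Ordinal lt)) //= subKn; last lia.
  rewrite eqxx big1 // => i; rewrite -val_eqE /= => ne.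
  by have := ltn_ord i; case: eqP => //; move/eqP: ne; lia.
have [|||x xC xE] := @Comp_of_seq k.+1 b (rcons P (b - sumn P)).
- by rewrite size_rcons size_map size_iota.
- by rewrite all_rcons all_map sP; apply/andP; split; [lia|apply/allP].
- by rewrite sumn_rcons subnKC // sP; lia.
exists x => //; apply: (@sorted_eq _ geq) => //.
- by move=> p q r /= qp rq; apply: leq_trans rq qp.
- by move=> p q; rewrite /= andbC -eqn_leq => /eqP.
- exact: psi_sorted.
apply/allP => c; rewrite mem_cat => ch /=.
have cb : 0 < c < k.+1 by case/orP: ch => [/psi_bounds | /(allP bl)].
rewrite count_psi // xE nth_rcons size_map size_iota ifT; last lia.
rewrite (nth_map 0) ?size_iota ?nth_iota; [|lia|lia].
by rewrite subn1 /= add0n (_ : k - (k.+1 - c).-1 = c) //; lia.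
Qed.

(** Reindexing along [psi_inv]. The type of [L u k] depends on [u], so [u] is a variable fixed by an
    equation instead of a rewritten expression. *)
Lemma sum_L (k b : nat) (F : k.+1.-tuple 'I_b.+1 -> nat) (u : int) :
  u = (Posz b - Posz k.+1)%R ->
  \sum_(lam in L u k) F (psi_inv k.+1 b (map val lam))
    = \sum_(q in Comp k.+1 b) F q.
Proof.
move=> uE; have absu : (0 <= u)%R -> `|u|%N + k.+1 = b.
  by rewrite uE; lia.
pose h (lam : `|u|%N.-bseq 'I_k.+1) := psi_inv k.+1 b (map val lam).
have hP lam : lam \in L u k -> h lam \in Comp k.+1 b /\ psi (h lam) = map val lam.
  rewrite inE => /and3P[u0 pos srt].
  have [||x xC xE] := @psi_surj k b (map val lam) _ srt.
  - by apply/allP => _ /mapP[t /(allP pos) t0 ->]; rewrite t0 ltn_ord.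
  - by rewrite size_map -(absu u0) leq_add2r size_bseq.
  rewrite /h /psi_inv; case: pickP => [y /andP[yC /eqP yE] // | /(_ x)].
  by rewrite xC xE eqxx.
have h_inj : {in L u k &, injective h}.
  move=> l1 l2 /hP[_ e1] /hP[_ e2] eq_h; apply/val_inj/(inj_map val_inj).
  by rewrite -e1 -e2 eq_h.
rewrite -(big_imset F h_inj); apply: eq_bigl => x.
apply/imsetP/idP => [[lam /hP[hC _] ->] // | xC].
(* This bound also forces u to be nonnegative: for negative u both index sets are empty. *)
have szx := size_psi xC.
have sz : size (map inord (psi x) : seq 'I_k.+1) <= `|u|%N by rewrite size_map; lia.
have lamE : map val (Bseq sz) = psi x.
  rewrite -[RHS]map_id -map_comp; apply/eq_in_map => c /psi_bounds /andP[_ ck] /=.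
  by rewrite inordK.
have lamL : Bseq sz \in L u k.
  rewrite inE lamE psi_sorted andbT; apply/andP; split; first lia.
  rewrite -(all_map val (fun t => 0 < t)) lamE.
  by apply/allP => c /psi_bounds/andP[].
exists (Bseq sz) => //; have [hC hE] := hP _ lamL.
by apply: psi_inj => //; rewrite hE.
Qed.

Theorem theorem6p1 (n : nat) (hn : 1 <= n) :
  #|stack_sort_preim (Av n [:: [:: 2; 3; 1]; [:: 3; 1; 2]; [:: 3; 2; 1]])|
    = \sum_(0 <= k < n) \sum_(q in Comp k.+1 (n - k)) compC q * compD q
  /\
  \sum_(0 <= k < n) \sum_(q in Comp k.+1 (n - k)) compC q * compD q
    = \sum_(0 <= k < n)
        \sum_(lam in L (Posz n - 2 * Posz k - 1)%R k)
          compC (psi_inv k.+1 (n - k) (map val lam))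
          * compD (psi_inv k.+1 (n - k) (map val lam)).
Proof.
split.
  rewrite card_stack_sort_preim_av sum_codes_comps //.
  by apply: eq_bigr => k _; rewrite sum_Comp.
apply: eq_big_nat => k /andP[_ kn].
(* Since k < n, the truncated [n - k] is exact, and (n - k) - (k + 1) = n - 2k - 1. *)
rewrite (@sum_L k (n - k) (fun q => compC q * compD q)) //; lia.
Qed.
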